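(* Let $M$ be a commutative monoid, let $0\to\mathcal{B}\to K\xrightarrow{q}M\to0$ be a versal coextension, and let $\mathcal{A}\in\mathcal{H}(M)$. There is an exact sequence $$0\to\mathsf{D}^0(M,\mathcal{A})\xrightarrow{\eta}D(q)\xrightarrow{\theta}\mathrm{Hom}_{\mathcal{H}(M)}(\mathcal{B},\mathcal{A})\xrightarrow{\tau}\mathsf{D}^1(M,\mathcal{A})\to0.$$
   Context: **Systems.** All monoids are commutative, written multiplicatively with unit $1$. A system of abelian groups $\mathcal{A}$ over $M$ consists of an abelian group $\mathcal{A}(a)$ for each $a\in M$ and homomorphisms $r_*:\mathcal{A}(a)\to\mathcal{A}(ra)$ for all $r,a\in M$ with $1_*=\mathrm{id}$ and $(rs)_*=r_*\circ s_*$. A morphism is a family of homomorphisms $\alpha(a):\mathcal{A}(a)\to\mathcal{B}(a)$ commuting with all $r_*$; the category is $\mathcal{H}(M)$. For a monoid homomorphism $\varphi:K\to M$, $(\varphi^*\mathcal{A})(k)=\mathcal{A}(\varphi(k))$ with $r_*$ given by $\varphi(r)_*$. **Coextensions.** A coextension $0\to\mathcal{A}\to N\xrightarrow{\pi}M\to0$ of $M$ by $\mathcal{A}$ is a surjective monoid homomorphism $\pi:N\to M$ with an action $\bullet$ of the group $\mathcal{A}(m)$ on $\pi^{-1}(m)$ for each $m\in M$ such that (i) for $n,n'\in\pi^{-1}(m)$ there is a unique $x\in\mathcal{A}(m)$ with $n'=x\bullet n$; (ii) $(x\bullet n)(y\bullet n')=(m'_*(x)+m_*(y))\bullet(nn')$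 for $x\in\mathcal{A}(m)$, $n\in\pi^{-1}(m)$, $y\in\mathcal{A}(m')$, $n'\in\pi^{-1}(m')$. A morphism of coextensions of $M$ from $(\mathcal{B},K,q)$ to $(\mathcal{A},N,\pi)$ is a triple $(\alpha,h,\mathrm{id}_M)$ with $\alpha:\mathcal{B}\to\mathcal{A}$ in $\mathcal{H}(M)$ and $h:K\to N$ a monoid homomorphism with $\pi h=q$ and $h(x\bullet k)=\alpha(x)\bullet h(k)$. A coextension $0\to\mathcal{B}\to K\xrightarrow{q}M\to0$ is versal if it admits such a morphism to any coextension $0\to\mathcal{A}\to N\xrightarrow{\pi}M\to0$ of $M$ (for any $\mathcal{A}$). **Grillet cohomology.** $\mathsf{D}^0(M,\mathcal{A})$ is the group of derivations, i.e. functions $g$ with $g(a)\in\mathcal{A}(a)$ and $g(ab)=a_*g(b)+b_*g(a)$. $\mathsf{D}^1(M,\mathcal{A})$ is the group of functions $f$ with $f(a,b)\in\mathcal{A}(ab)$, $f(a,b)=f(b,a)$ and $a_*f(b,c)-f(ab,c)+f(a,bc)-c_*f(a,b)=0$, modulo those of the form $(a,b)\mapsto a_*g(b)-g(ab)+b_*g(a)$ with $g(a)\in\mathcal{A}(a)$. The class in $\mathsf{D}^1(M,\mathcal{A})$ of a coextension $\pi:N\to M$ by $\mathcal{A}$ is that of $f$ defined by $\sigma(a)\sigma(b)=f(a,b)\bullet\sigma(ab)$ for a choice of set-theoretic section $\sigma$ of $\pi$. **The terms and maps.** $D(q)$ is the group of derivations $\partial:K\to q^*\mathcal{A}$ (so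 $\partial(k)\in\mathcal{A}(q(k))$ and $\partial(kk')=q(k)_*\partial(k')+q(k')_*\partial(k)$) satisfying $\partial((x+y)\bullet n)+\partial(n)=\partial(x\bullet n)+\partial(y\bullet n)$ for all $n\in K$, $x,y\in\mathcal{B}(q(n))$. $\eta(\delta)=\delta\circ q$. $\theta(\partial)(m)(x)=\partial(x\bullet n)-\partial(n)$ for $x\in\mathcal{B}(m)$ and any $n\in q^{-1}(m)$. $\tau(\alpha)$ is the class of the push-forward $\alpha_*$ of the given coextension: its monoid is the set of classes $[y,n]$ of pairs $n\in K$, $y\in\mathcal{A}(q(n))$ under $(y,n)\sim(y-\alpha(x),x\bullet n)$, $x\in\mathcal{B}(q(n))$, with product $[y,n][z,n']=[q(n')_*y+q(n)_*z,nn']$, projection $[y,n]\mapsto q(n)$ and action $u\bullet[y,n]=[u+y,n]$. *)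

(* Defs.v *)
From HB Require Import structures.
From mathcomp Require Import all_boot all_algebra.
From mathcomp Require Import boolp.

Set Implicit Arguments.
Unset Strict Implicit.
Unset Printing Implicit Defensive.

Import GRing.Theory.
Local Open Scope quotient_scope.
Local Open Scope ring_scope.
Local Open Scope group_scope.

(* MathComp's multiplicative monoids, abelian groups, etc. carry a choiceType;
   classically every set has such a structure, so this is no restriction. *)
HB.mixin Record Monoid_isCommutative G of monoid.Monoid G := {
  commM : commutative ( *%g : G -> G -> G)
}.

#[short(type="comMonoidType")]
HB.structure Definition ComMonoid :=
  {G of Monoid_isCommutative G & monoid.Monoid G}.

Notation "{ 'monoidHom' K -> M }" := (UMagmaMorphism.type K%type M%type)
  (at level 0, K at level 98, M at level 99,
   format "{ 'monoidHom'  K  ->  M }") : type_scope.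

(* An alias for the dependent product, so that the pointwise group structure
   does not interfere with other instances on function types. *)
Definition family (T : Type) (F : T -> zmodType) : Type := forall t, F t.

Section Family.
Variables (T : Type) (F : T -> zmodType).
HB.instance Definition _ := Choice.on (family F).

Let zero : family F := fun t => 0.
Let opp (f : family F) : family F := fun t => - f t.
Let add (f g : family F) : family F := fun t => f t + g t.

Fact family_addA : associative add.
Proof.
by move=> f g h; apply: functional_extensionality_dep => t; exact: addrA.
Qed.
Fact family_addC : commutative add.
Proof.
by move=> f g; apply: functional_extensionality_dep => t; exact: addrC.
Qed.
Fact family_add0 : left_id zero add.
Proof.
by move=> f; apply: functional_extensionality_dep => t; exact: add0r.
Qed.
Fact family_addN : left_inverse zero opp add.
Proof.
by move=> f; apply: functional_extensionality_dep => t; exact: addNr.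
Qed.

HB.instance Definition _ :=
  GRing.isZmodule.Build (family F) family_addA family_addC family_add0 family_addN.

Lemma family0E t : (0 : family F) t = 0. Proof. by []. Qed.
Lemma familyDE (f g : family F) t : (f + g) t = f t + g t. Proof. by []. Qed.
Lemma familyNE (f : family F) t : (- f) t = - f t. Proof. by []. Qed.
Lemma familyBE (f g : family F) t : (f - g) t = f t - g t. Proof. by []. Qed.
End Family.
Definition familyE := (family0E, familyDE, familyNE, familyBE).

Definition transport (T : Type) (F : T -> zmodType) (a b : T) (e : a = b) :
  F a -> F b := fun x => eq_rect a F x b e.

Fact transport_additive T F a b e : zmod_morphism (@transport T F a b e).
Proof. by case: b / e => x y. Qed.
HB.instance Definition _ T F a b e :=
  GRing.isZmodMorphism.Build (F a) (F b) (@transport T F a b e)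
    (@transport_additive T F a b e).

Lemma transport_id (T : eqType) (F : T -> zmodType) a (e : a = a) (x : F a) :
  transport e x = x.
Proof. by rewrite (eq_irrelevance e erefl). Qed.

Lemma transport_comp (T : eqType) (F : T -> zmodType) a b c
    (e : a = b) (e' : b = c) (x : F a) :
  transport e' (transport e x) = transport (etrans e e') x.
Proof. by case: c / e'; case: b / e. Qed.

Lemma transport_inj (T : eqType) (F : T -> zmodType) a b (e : a = b) :
  injective (transport (F := F) e).
Proof. by case: b / e => x y. Qed.

(* The groups A(1a), A(r(sa)), etc. are only propositionally equal to A(a),
   A((rs)a), etc.; [transport] is the identification between them. *)
Record system (M : comMonoidType) := System {
  sys :> M -> zmodType;
  sys_map : forall r a, {additive sys a -> sys (r * a)%g};
  sys_map1 : forall a (x : sys a), transport (mul1g a) (sys_map 1 a x) = x;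
  sys_mapM : forall r s a (x : sys a),
    transport (mulgA r s a) (sys_map r (s * a) (sys_map s a x)) =
    sys_map (r * s) a x
}.

(* [r #* x] is r_* x in A(ra); [x *# r] is the same element seen in A(ar). *)
Notation "r '#*' x" := (sys_map _ r _ x) (at level 40, x at next level).
Definition sys_mapr (M : comMonoidType) (A : system M) (a r : M) (x : A a) :
  A (a * r) := transport (commM r a) (r #* x).
Notation "x '*#' r" := (sys_mapr r x) (at level 40, r at next level).

Section SystemTheory.
Variables (M : comMonoidType) (A : system M).

(* r_* followed by the identification of A(ra) with A(b), given ra = b. *)
Definition push (a r b : M) (e : r * a = b) (x : A a) : A b :=
  transport e (r #* x).

Fact push_additive a r b e : zmod_morphism (@push a r b e).
Proof. by move=> x y; rewrite /push !raddfB. Qed.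
HB.instance Definition _ a r b e :=
  GRing.isZmodMorphism.Build (A a) (A b) (@push a r b e) (@push_additive a r b e).

Lemma sys_map_push r a (x : A a) : r #* x = push erefl x.
Proof. by []. Qed.

Lemma sys_mapr_push r a (x : A a) : x *# r = push (commM r a) x.
Proof. by []. Qed.

Lemma transport_push r a b c (e : r * a = b) (e' : b = c) (x : A a) :
  transport e' (push e x) = push (etrans e e') x.
Proof. by rewrite /push transport_comp. Qed.

Lemma pushE r r' a b (e : r * a = b) (e' : r' * a = b) (x : A a) :
  r = r' -> push e x = push e' x.
Proof. by move=> rr'; subst r'; rewrite (eq_irrelevance e e'). Qed.

Lemma push1 a (e : 1 * a = a) (x : A a) : push e x = x.
Proof. by rewrite (eq_irrelevance e (mul1g a)) /push sys_map1. Qed.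

Lemma push_transport (r a b c : M) (e : a = b) (e' : r * b = c) (x : A a) :
  push e' (transport e x) = push (etrans (congr1 (fun z : M => r * z) e) e') x.
Proof. by subst b; rewrite /=; apply: pushE. Qed.

Fact push_push_subproof (r s a b c : M) : s * a = b -> r * b = c -> r * s * a = c.
Proof. by move=> <- <-; rewrite mulgA. Qed.

Lemma push_push (r s a b c : M) (e : s * a = b) (e' : r * b = c) (x : A a) :
  push e' (push e x) = push (push_push_subproof e e') x.
Proof.
subst b c; by rewrite [RHS]/push -sys_mapM transport_comp transport_id.
Qed.

End SystemTheory.

Section Pullback.
Variables (K M : comMonoidType) (phi : {monoidHom K -> M}) (A : system M).

Let F (k : K) : zmodType := A (phi k).

Definition pullback_map (r a : K) : {additive F a -> F (r * a)%g} :=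
  @transport M A (phi r * phi a) (phi (r * a)) (esym (gmulfM r a))
    \o sys_map A (phi r) (phi a).

Fact pullback_transport a b (e : a = b) (x : F a) :
  transport e x = @transport M A _ _ (congr1 phi e) x.
Proof. by subst b. Qed.

Fact pullback_map1 a (x : F a) :
  transport (mul1g a) (pullback_map 1 a x) = x.
Proof.
rewrite pullback_transport /= transport_comp -/(push _ _).
have e : 1 * phi a = phi a by rewrite mul1g.
by rewrite (pushE _ e) ?gmulf1 ?push1.
Qed.

Fact pullback_mapM r s a (x : F a) :
  transport (mulgA r s a) (pullback_map r (s * a) (pullback_map s a x)) =
  pullback_map (r * s) a x.
Proof.
rewrite pullback_transport /= transport_comp -!/(push _ _) push_push.
by apply: pushE; rewrite gmulfM.
Qed.

Definition pullback : system K := System pullback_map1 pullback_mapM.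
End Pullback.

Section Fibers.
Variables (N M : comMonoidType) (phi : {monoidHom N -> M}).

Definition fiber (m : M) : Type := {n : N | phi n == m}.

Lemma fiberP m (n : fiber m) : phi (val n) = m.
Proof. exact: eqP (valP n). Qed.

Definition in_fiber (m : M) (n : N) (e : phi n = m) : fiber m :=
  Sub n (introT eqP e).

Fact fiber_mul_subproof m m' (n : fiber m) (n' : fiber m') :
  phi (val n * val n') = m * m'.
Proof. by rewrite gmulfM !fiberP. Qed.

Definition fiber_mul m m' (n : fiber m) (n' : fiber m') : fiber (m * m') :=
  in_fiber (fiber_mul_subproof n n').
End Fibers.

Record coextension (M : comMonoidType) (A : system M) := Coextension {
  coext_monoid :> comMonoidType;
  proj : {monoidHom coext_monoid -> M};
  proj_surj : forall m, exists n, proj n = m;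
  coact : forall m, A m -> fiber proj m -> fiber proj m;
  coact0 : forall m (n : fiber proj m), coact 0 n = n;
  coactD : forall m (x y : A m) (n : fiber proj m),
    coact (x + y) n = coact x (coact y n);
  coact_torsor : forall m (n n' : fiber proj m), exists! x, n' = coact x n;
  coactM : forall m m' (x : A m) (n : fiber proj m)
      (y : A m') (n' : fiber proj m'),
    fiber_mul (coact x n) (coact y n') =
    coact (x *# m' + m #* y) (fiber_mul n n')
}.
Arguments proj {M A} c.
Arguments coact {M A c m} x n.
Notation "x • n" := (coact x n) (at level 40, n at next level).

Section SystemHom.
Variables (M : comMonoidType) (B A : system M).

Definition hom_family := family (fun m : M => family (fun _ : B m => A m)).

Definition is_hom (alpha : hom_family) :=
  (forall m, {morph alpha m : x y / x + y}) /\
  (forall r m (x : B m), alpha (r * m) (r #* x) = r #* alpha m x).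

Definition hom_pred : {pred hom_family} := fun alpha => `[< is_hom alpha >].

Fact hom_pred_zmod_closed : zmod_closed hom_pred.
Proof.
split; first by apply/asboolP; split=> [m x y|r m x]; rewrite !familyE ?addr0 ?raddf0.
move=> f g /asboolP[fD fM] /asboolP[gD gM]; apply/asboolP.
by split=> [m x y|r m x]; rewrite !familyE; [rewrite fD gD opprD addrACA|rewrite fM gM raddfB].
Qed.
HB.instance Definition _ :=
  GRing.isZmodClosed.Build hom_family hom_pred hom_pred_zmod_closed.

Record system_hom := MkSystemHom { hom_fun : hom_family; _ : hom_fun \in hom_pred }.
HB.instance Definition _ := [isSub for hom_fun].
HB.instance Definition _ := [Choice of system_hom by <:].
HB.instance Definition _ := [SubChoice_isSubZmodule of system_hom by <:].

Definition hom_apply (alpha : system_hom) (m : M) : B m -> A m := @hom_fun alpha m.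
Coercion hom_apply : system_hom >-> Funclass.
End SystemHom.

Definition fiber_map (K N M : comMonoidType) (q : {monoidHom K -> M})
    (pi : {monoidHom N -> M}) (h : K -> N) (pi_h : forall k, pi (h k) = q k)
    (m : M) (k : fiber q m) : fiber pi m :=
  in_fiber (etrans (pi_h (val k)) (fiberP k)).

Record coext_morphism (M : comMonoidType) (B A : system M)
    (E : coextension B) (C : coextension A) := CoextMorphism {
  mor_sys : system_hom B A;
  mor_monoid : {monoidHom E -> C};
  mor_proj : forall k, proj C (mor_monoid k) = proj E k;
  mor_act : forall m (x : B m) (k : fiber (proj E) m),
    fiber_map mor_proj (x • k) = mor_sys m x • fiber_map mor_proj k
}.

Definition versal (M : comMonoidType) (B : system M) (E : coextension B) :
    Prop :=
  forall (A : system M) (C : coextension A), inhabited (coext_morphism E C).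

Section Derivations.
Variables (M : comMonoidType) (A : system M).

Definition is_derivation (g : family A) : Prop :=
  forall a b, g (a * b) = a #* g b + g a *# b.

Definition derivation_pred : {pred family A} := fun g => `[< is_derivation g >].

Fact sys_mapr_additive a r : zmod_morphism (@sys_mapr M A a r).
Proof. by move=> x y; rewrite /sys_mapr !raddfB. Qed.
HB.instance Definition _ a r :=
  GRing.isZmodMorphism.Build (A a) (A (a * r)) (@sys_mapr M A a r)
    (@sys_mapr_additive a r).

Fact derivation_pred_zmod_closed : zmod_closed derivation_pred.
Proof.
split; first by apply/asboolP => a b; rewrite !familyE !raddf0 addr0.
move=> f g /asboolP fD /asboolP gD; apply/asboolP => a b.
by rewrite !familyE fD gD !raddfB opprD addrACA.
Qed.
HB.instance Definition _ :=
  GRing.isZmodClosed.Build (family A) derivation_pred derivation_pred_zmod_closed.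

Record D0 := MkD0 { der_fun : family A; _ : der_fun \in derivation_pred }.
HB.instance Definition _ := [isSub for der_fun].
HB.instance Definition _ := [Choice of D0 by <:].
HB.instance Definition _ := [SubChoice_isSubZmodule of D0 by <:].

Definition der_apply (g : D0) (a : M) : A a := @der_fun g a.
Coercion der_apply : D0 >-> Funclass.
End Derivations.

Section D1.
Variables (M : comMonoidType) (A : system M).

Fact altsumB (V : zmodType) (x y z t x' y' z' t' : V) :
  x - x' + (- y - - y') + (z - z') + (- t - - t') =
  x - y + z - t - (x' - y' + z' - t').
Proof.
by rewrite !opprK [x - x' + _]addrACA [_ + _ + (z - z')]addrACA [LHS]addrACA !opprD !opprK.
Qed.

Definition cochain2 := family (fun a : M => family (fun b : M => A (a * b))).

Definition is_cocycle (f : cochain2) : Prop :=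
  (forall a b, f a b = transport (commM b a) (f b a)) /\
  (forall a b c,
    transport (mulgA a b c) (a #* f b c) - f (a * b) c
    + transport (mulgA a b c) (f a (b * c)) - f a b *# c = 0).

Definition cocycle_pred : {pred cochain2} := fun f => `[< is_cocycle f >].

Fact cocycle_pred_zmod_closed : zmod_closed cocycle_pred.
Proof.
split.
  by apply/asboolP; split=> *; rewrite !familyE !raddf0 ?subr0 ?addr0.
move=> f g /asboolP[fC fD] /asboolP[gC gD]; apply/asboolP; split=> [a b|a b c].
  by rewrite !familyE raddfB /= -fC -gC.
by rewrite !familyE !raddfB /= altsumB fD gD subrr.
Qed.
HB.instance Definition _ :=
  GRing.isZmodClosed.Build cochain2 cocycle_pred cocycle_pred_zmod_closed.

Record cocycle := MkCocycle { coc_fun : cochain2; _ : coc_fun \in cocycle_pred }.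
HB.instance Definition _ := [isSub for coc_fun].
HB.instance Definition _ := [Choice of cocycle by <:].
HB.instance Definition _ := [SubChoice_isSubZmodule of cocycle by <:].

Definition coc_apply (f : cocycle) (a b : M) : A (a * b) := @coc_fun f a b.
Coercion coc_apply : cocycle >-> Funclass.

Definition is_coboundary (f : cocycle) : Prop :=
  exists g : family A, forall a b, f a b = a #* g b - g (a * b) + g a *# b.

Definition coboundary_pred : {pred cocycle} := fun f => `[< is_coboundary f >].

Fact coboundary_pred_zmod_closed : zmod_closed coboundary_pred.
Proof.
split.
  by apply/asboolP; exists 0 => a b; rewrite !familyE !raddf0 ?oppr0 !addr0.
move=> f f' /asboolP[g fg] /asboolP[g' fg']; apply/asboolP; exists (g - g') => a b.
have -> : (f - f') a b = f a b - f' a b by [].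
rewrite fg fg' !familyE !raddfB /=.
by rewrite [X in _ = X + _]addrACA [RHS]addrACA !opprD !opprK.
Qed.
HB.instance Definition _ :=
  GRing.isZmodClosed.Build cocycle coboundary_pred coboundary_pred_zmod_closed.

Definition D1 : zmodType := Quotient.quot coboundary_pred.
Definition coc_class (f : cocycle) : D1 :=
  \pi_(Quotient.quot coboundary_pred) f.
End D1.

Section FactorSet.
Variables (M : comMonoidType) (A : system M) (C : coextension A).
Variable sigma : forall a : M, fiber (proj C) a.

Lemma coact_inj m (x y : A m) (n : fiber (proj C) m) : x • n = y • n -> x = y.
Proof.
move=> xy; have [z [_ zu]] := coact_torsor n (x • n).
by rewrite -(zu x) // -(zu y).
Qed.

Lemma coact_transport m m' (e : m = m') (x : A m) (n : fiber (proj C) m)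
  (n' : fiber (proj C) m') :
  val n = val n' -> val (x • n) = val (transport e x • n').
Proof.
by subst m' => nn'; congr (val (_ • _)); apply: val_inj.
Qed.

Definition factor_fun : cochain2 A := fun a b =>
  sval (cid (coact_torsor (sigma (a * b)) (fiber_mul (sigma a) (sigma b)))).

Lemma factor_funP a b :
  fiber_mul (sigma a) (sigma b) = factor_fun a b • sigma (a * b).
Proof. by rewrite /factor_fun; case: cid => x /= []. Qed.

Fact factor_fun_cocycle : factor_fun \in @cocycle_pred M A.
Proof.
have eqP m m' (e : m = m') (x : A m) (y : A m') :
    val (x • sigma m) = val (y • sigma m') -> transport e x = y.
  move=> h; apply: (@coact_inj _ _ _ (sigma m')); apply: val_inj; rewrite -h.
  by symmetry; apply: coact_transport; subst m'.
apply/asboolP; split=> [a b|a b c].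
  by symmetry; apply: eqP; rewrite -!factor_funP /= commM.
have : transport (mulgA a b c) (a #* factor_fun b c + factor_fun a (b * c)) =
       factor_fun a b *# c + factor_fun (a * b) c.
  apply: eqP; rewrite !coactD -!factor_funP.
  have L : fiber_mul (sigma a) (factor_fun b c • sigma (b * c)) =
       (a #* factor_fun b c) • fiber_mul (sigma a) (sigma (b * c)).
    by rewrite -{1}(coact0 (sigma a)) coactM raddf0 add0r.
  have R : fiber_mul (factor_fun a b • sigma (a * b)) (sigma c) =
       (factor_fun a b *# c) • fiber_mul (sigma (a * b)) (sigma c).
    by rewrite -{1}(coact0 (sigma c)) coactM raddf0 addr0.
  by rewrite -L -R -!factor_funP /= mulgA.
rewrite raddfD /= => h.
by rewrite [_ - _ + _]addrAC h -addrA -opprD [factor_fun (a * b) c + _]addrC subrr.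
Qed.

(* The symmetric 2-cocycle f with sigma(a)sigma(b) = f(a,b) • sigma(ab). *)
Definition factor_set : cocycle A := MkCocycle factor_fun_cocycle.
End FactorSet.

Section Dq.
Variables (M : comMonoidType) (B : system M) (K : coextension B) (A : system M).

Let q := proj K.

(* The value at n in q^-1(m) of d : K -> q^* A, as an element of A(m). *)
Definition der_at (d : D0 (pullback q A)) (m : M) (n : fiber q m) : A m :=
  transport (fiberP n) (d (val n) : A (q (val n))).

Definition Dq_cond (d : D0 (pullback q A)) : Prop :=
  forall m (x y : B m) (n : fiber q m),
    der_at d ((x + y) • n) + der_at d n = der_at d (x • n) + der_at d (y • n).

Definition Dq_pred : {pred D0 (pullback q A)} := fun d => `[< Dq_cond d >].

Lemma der_atB d d' m (n : fiber q m) :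
  der_at (d - d') n = der_at d n - der_at d' n.
Proof. by rewrite /der_at -raddfB. Qed.

Fact Dq_pred_zmod_closed : zmod_closed Dq_pred.
Proof.
split.
  apply/asboolP => m x y n.
  by have d0 z : der_at 0 z = 0 :> A m; [rewrite /der_at raddf0|rewrite !d0].
move=> d d' /asboolP dP /asboolP d'P; apply/asboolP => m x y n.
by rewrite !der_atB addrACA dP -opprD d'P opprD addrACA.
Qed.
HB.instance Definition _ :=
  GRing.isZmodClosed.Build (D0 (pullback q A)) Dq_pred Dq_pred_zmod_closed.

Record Dq := MkDq { Dq_der :> D0 (pullback q A); _ : Dq_der \in Dq_pred }.
HB.instance Definition _ := [isSub for Dq_der].
HB.instance Definition _ := [Choice of Dq by <:].
HB.instance Definition _ := [SubChoice_isSubZmodule of Dq by <:].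
End Dq.

Section Pushforward.
Variables (M : comMonoidType) (B : system M) (K : coextension B) (A : system M).
Variable alpha : system_hom B A.

Let q := proj K.

Fact homD m (x y : B m) : alpha m (x + y) = alpha m x + alpha m y.
Proof. by case: alpha => f /= /asboolP[/(_ m) fD _]; exact: fD. Qed.

Fact homM r m (x : B m) : alpha (r * m) (r #* x) = r #* alpha m x.
Proof. by case: alpha => f /= /asboolP[_ fM]; exact: fM. Qed.

Fact hom0 m : alpha m 0 = 0.
Proof. by apply: (addrI (alpha m 0)); rewrite -homD !addr0. Qed.

Fact homN m (x : B m) : alpha m (- x) = - alpha m x.
Proof. by apply: (addrI (alpha m x)); rewrite -homD !subrr hom0. Qed.

Fact hom_transport m m' (e : m = m') (x : B m) :
  alpha m' (transport e x) = transport e (alpha m x).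
Proof. by subst m'. Qed.

Fact homMr r m (x : B m) : alpha (m * r) (x *# r) = alpha m x *# r.
Proof. by rewrite /sys_mapr hom_transport homM. Qed.

Definition pf_raw : Type := {n : K & A (q n)}.

(* The pair (y, n) when q(n) = m, with y in A(m) seen as an element of A(q(n)). *)
Definition pf_pair (m : M) (y : A m) (n : fiber q m) : pf_raw :=
  Tagged (fun n : K => A (q n)) (transport (esym (fiberP n)) y).

Definition pf_rel (p p' : pf_raw) : Prop :=
  exists m (y : A m) (n : fiber q m) (x : B m),
    p = pf_pair y n /\ p' = pf_pair (y - alpha m x) (x • n).

Definition pf_fiber (p : pf_raw) : fiber q (q (tag p)) := in_fiber erefl.

Lemma pf_pairK (p : pf_raw) : pf_pair (tagged p) (pf_fiber p) = p.
Proof.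
case: p => n y; rewrite /pf_pair /= transport_id.
by [].
Qed.

Lemma pf_pair_ex (p : pf_raw) m : q (tag p) = m ->
  exists (y : A m) (n : fiber q m), p = pf_pair y n.
Proof.
by move=> e; subst m; exists (tagged p), (pf_fiber p); rewrite pf_pairK.
Qed.

Lemma pf_pair_eq m m' (e : m = m') (y : A m) n (y' : A m') n' :
  val n = val n' -> transport e y = y' -> pf_pair y n = pf_pair y' n'.
Proof.
by subst m' => nn' <-; congr (pf_pair _ _); apply: val_inj.
Qed.

Lemma pf_pair_inj m (y y' : A m) n n' :
  pf_pair y n = pf_pair y' n' -> y = y' /\ n = n'.
Proof.
move=> h; have nn' : n = n' by apply: val_inj; exact: (congr1 tag h).
subst n'; split=> //; have: pf_pair y n == pf_pair y' n :> {n : K & A (q n)} by apply/eqP.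
by rewrite /pf_pair eq_Tagged /= => /eqP h'; exact: (transport_inj h').
Qed.

Lemma pf_relP m (y y' : A m) n n' :
  pf_rel (pf_pair y n) (pf_pair y' n') <->
  exists x : B m, y' = y - alpha m x /\ n' = x • n.
Proof.
split=> [[m0 [y0 [n0 [x [e e']]]]]|[x [-> ->]]]; last by exists m, y, n, x.
have mm0 : m = m0.
  by rewrite -(fiberP n) -(fiberP n0); exact: (congr1 q (congr1 tag e)).
subst m0.
by case: (pf_pair_inj e) => -> ->; case: (pf_pair_inj e') => -> ->; exists x.
Qed.

Lemma pf_rel_tag p p' : pf_rel p p' -> q (tag p) = q (tag p').
Proof. by move=> [m [y [n [x [-> ->]]]]]; rewrite /= !fiberP. Qed.

Definition pf_relb (p p' : pf_raw) : bool := `[< pf_rel p p' >].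

Fact pf_relb_equiv : equiv_class_of pf_relb.
Proof.
have refl p : pf_rel p p.
  rewrite -(pf_pairK p); apply/pf_relP; exists 0.
  by rewrite hom0 subr0 coact0.
have sym p p' : pf_rel p p' -> pf_rel p' p.
  move=> [m [y [n [x [-> ->]]]]]; apply/pf_relP; exists (- x).
  by rewrite homN opprK subrK -coactD addNr coact0.
have trans p p' p'' : pf_rel p p' -> pf_rel p' p'' -> pf_rel p p''.
  move=> [m [y [n [x [-> ->]]]]] h.
  have := pf_rel_tag h; rewrite /= fiberP => e.
  have [y' [n' e']] := pf_pair_ex (esym e); subst p''.
  move/pf_relP: h => [x' [-> ->]]; apply/pf_relP; exists (x' + x).
  by rewrite homD coactD opprD (addrC (- _) (- _)) addrA.
split=> [p|p p'|p' p p''].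
- exact/asboolP.
- by apply/asboolP/asboolP; exact: sym.
- by move=> /asboolP h /asboolP h'; apply/asboolP; exact: trans h h'.
Qed.
Canonical pf_relb_equivrel := EquivRelPack pf_relb_equiv.
Canonical pf_relb_encmodrel := defaultEncModRel pf_relb.

Definition pf_carrier : Type := {eq_quot pf_relb}.
HB.instance Definition _ := Choice.on pf_carrier.
HB.instance Definition _ := EqQuotient.on pf_carrier.

(* The class [y, n]. *)
Definition pf_class (m : M) (y : A m) (n : fiber q m) : pf_carrier :=
  \pi_pf_carrier (pf_pair y n).

Lemma pf_classP m (y y' : A m) n n' :
  pf_class y n = pf_class y' n' <->
  exists x : B m, y' = y - alpha m x /\ n' = x • n.
Proof.
rewrite -pf_relP /pf_class; split=> [/eqP|h]; first by rewrite piE => /asboolP.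
by apply/eqP; rewrite piE; apply/asboolP.
Qed.

Lemma pf_class_eq m m' (e : m = m') (y : A m) n (y' : A m') n' :
  val n = val n' -> transport e y = y' -> pf_class y n = pf_class y' n'.
Proof. by move=> nn' yy'; rewrite /pf_class (pf_pair_eq nn' yy'). Qed.

Definition pf_proj_fun (P : pf_carrier) : M := q (tag (repr P)).

Lemma pf_proj_class m (y : A m) n : pf_proj_fun (pf_class y n) = m.
Proof.
rewrite /pf_proj_fun /pf_class; case: piP => p /eqP; rewrite piE.
by move/asboolP/pf_rel_tag => <-; exact: fiberP.
Qed.

Lemma pf_class_ex (P : pf_carrier) m : pf_proj_fun P = m ->
  exists (y : A m) (n : fiber q m), P = pf_class y n.
Proof.
move=> /pf_pair_ex[y [n e]]; exists y, n.
by rewrite /pf_class -e reprK.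
Qed.

(* See [pf_mulE] for the product and [pf_actE] for the action on classes. *)
Definition pf_mul_raw (p p' : pf_raw) : pf_raw :=
  pf_pair (tagged p *# q (tag p') + q (tag p) #* tagged p')
    (fiber_mul (pf_fiber p) (pf_fiber p')).

Definition pf_mul (P Q : pf_carrier) : pf_carrier :=
  \pi_pf_carrier (pf_mul_raw (repr P) (repr Q)).

Definition pf_one : pf_carrier :=
  \pi_pf_carrier (Tagged (fun n : K => A (q n)) (0 : A (q 1))).

Lemma pf_mul_rawE m m' (y : A m) n (y' : A m') n' :
  pf_mul_raw (pf_pair y n) (pf_pair y' n') =
  pf_pair (y *# m' + m #* y') (fiber_mul n n').
Proof.
case: n n' => [n e] [n' e']; move: (e) (e'); move/eqP: e y => <- y; move/eqP: e' y' => <- y' e e'.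
rewrite /pf_mul_raw /= !transport_id.
by congr (pf_pair _ _); apply: val_inj.
Qed.

Lemma pf_mulE m m' (y : A m) n (y' : A m') n' :
  pf_mul (pf_class y n) (pf_class y' n') =
  pf_class (y *# m' + m #* y') (fiber_mul n n').
Proof.
rewrite /pf_mul {1 2}/pf_class.
case: piP => p /eqP; rewrite piE => /asboolP h.
case: piP => p' /eqP; rewrite piE => /asboolP h'.
have := pf_rel_tag h; rewrite /= fiberP => /esym/pf_pair_ex [z [k e]]; subst p.
have := pf_rel_tag h'; rewrite /= fiberP => /esym/pf_pair_ex [z' [k' e]]; subst p'.
rewrite pf_mul_rawE; symmetry; apply/pf_classP.
move/pf_relP: h => [x [-> ->]]; move/pf_relP: h' => [x' [-> ->]].
exists (x *# m' + m #* x'); split; last exact: coactM.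
by rewrite homD homMr homM !raddfB opprD addrACA.
Qed.

Lemma pf_oneE (n : fiber q 1) : val n = 1 -> pf_one = pf_class 0 n.
Proof.
move=> n1; rewrite /pf_one /pf_class; congr (\pi_pf_carrier _).
rewrite -[LHS]pf_pairK; apply: (pf_pair_eq (e := gmulf1)); first by rewrite n1.
by rewrite /= raddf0.
Qed.

Fact pf_mulA : associative pf_mul.
Proof.
move=> P Q R.
have [y [n ->]] := pf_class_ex (erefl (pf_proj_fun P)).
have [z [k ->]] := pf_class_ex (erefl (pf_proj_fun Q)).
have [w [l ->]] := pf_class_ex (erefl (pf_proj_fun R)).
move: (pf_proj_fun P) (pf_proj_fun Q) (pf_proj_fun R) y n z k w l => a b c y n z k w l.
rewrite !pf_mulE; apply: (pf_class_eq (e := mulgA a b c)); first exact: mulgA.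
rewrite !raddfD /= addrA; congr (_ + _ + _).
- by rewrite !sys_mapr_push transport_push push_push; apply: pushE; rewrite commM.
- by rewrite !sys_mapr_push !sys_map_push transport_push !push_push; apply: pushE; rewrite commM.
- by rewrite !sys_map_push transport_push !push_push; apply: pushE.
Qed.

Fact pf_mulC : commutative pf_mul.
Proof.
move=> P Q.
have [y [n ->]] := pf_class_ex (erefl (pf_proj_fun P)).
have [z [k ->]] := pf_class_ex (erefl (pf_proj_fun Q)).
move: (pf_proj_fun P) (pf_proj_fun Q) y n z k => a b y n z k.
rewrite !pf_mulE; apply: (pf_class_eq (e := commM a b)); first exact: commM.
rewrite !raddfD /= addrC; congr (_ + _).
by rewrite !sys_mapr_push !sys_map_push transport_push; apply: pushE.
Qed.

Fact pf_mul1 : left_id pf_one pf_mul.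
Proof.
move=> P; have [y [n ->]] := pf_class_ex (erefl (pf_proj_fun P)).
move: (pf_proj_fun P) y n => a y n.
rewrite (@pf_oneE (in_fiber gmulf1)) // pf_mulE.
apply: (pf_class_eq (e := mul1g a)); first by rewrite /= mul1g.
by rewrite raddf0 add0r sys_map1.
Qed.

Fact pf_mulr1 : right_id pf_one pf_mul.
Proof. by move=> P; rewrite pf_mulC pf_mul1. Qed.

HB.instance Definition _ := isMonoid.Build pf_carrier pf_mulA pf_mul1 pf_mulr1.
HB.instance Definition _ := Monoid_isCommutative.Build pf_carrier pf_mulC.

Fact pf_proj_monoid_morphism :
  monoid.monoid_morphism (pf_proj_fun : pf_carrier -> M).
Proof.
split; first by rewrite /= -[1]/(pf_one) (@pf_oneE (in_fiber gmulf1)) // pf_proj_class.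
move=> P Q.
have [y [n ->]] := pf_class_ex (erefl (pf_proj_fun P)).
have [z [k ->]] := pf_class_ex (erefl (pf_proj_fun Q)).
by rewrite -[LHS]/(pf_proj_fun (pf_mul _ _)) pf_mulE !pf_proj_class.
Qed.
HB.instance Definition _ :=
  isUMagmaMorphism.Build pf_carrier M pf_proj_fun pf_proj_monoid_morphism.

Definition pf_proj : {monoidHom pf_carrier -> M} := pf_proj_fun.

Fact pf_proj_surj m : exists P, pf_proj P = m.
Proof.
have [n nm] := proj_surj K m.
by exists (pf_class 0 (in_fiber nm)); exact: pf_proj_class.
Qed.

Definition pf_fib (m : M) (y : A m) (n : fiber q m) : fiber pf_proj m :=
  in_fiber (pf_proj_class y n).

Definition pf_act (m : M) (u : A m) (P : fiber pf_proj m) : fiber pf_proj m :=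
  pf_fib (u + transport (fiberP P) (tagged (repr (val P)) : A (pf_proj (val P))))
    (in_fiber (fiberP P : q (tag (repr (val P))) = m)).

Lemma pf_fib_ex m (P : fiber pf_proj m) : exists y n, P = pf_fib y n.
Proof.
by have [y [n e]] := pf_class_ex (fiberP P); exists y, n; apply: val_inj.
Qed.

Lemma pf_fibP m (y y' : A m) n n' :
  pf_fib y n = pf_fib y' n' <->
  exists x : B m, y' = y - alpha m x /\ n' = x • n.
Proof.
rewrite -pf_classP; split=> [/(congr1 val)//|h]; exact: val_inj.
Qed.

Lemma pf_actE m (u y : A m) n : pf_act u (pf_fib y n) = pf_fib (u + y) n.
Proof.
rewrite /pf_act.
set k := in_fiber _; set z := transport _ _.
have e : pf_fib y n = pf_fib z k.
  apply: val_inj => /=; rewrite -[LHS]reprK /pf_class; congr (\pi_pf_carrier _).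
  rewrite -[LHS]pf_pairK /pf_class; apply: (pf_pair_eq (e := fiberP (pf_fib y n))) => //.
move/pf_fibP: e => [x [-> ->]]; symmetry; apply/pf_fibP; exists x.
by rewrite addrA.
Qed.

Fact pf_act0 m (P : fiber pf_proj m) : pf_act 0 P = P.
Proof. by have [y [n ->]] := pf_fib_ex P; rewrite pf_actE add0r. Qed.

Fact pf_actD m (x y : A m) (P : fiber pf_proj m) :
  pf_act (x + y) P = pf_act x (pf_act y P).
Proof. by have [z [n ->]] := pf_fib_ex P; rewrite !pf_actE addrA. Qed.

Fact pf_act_torsor m (P P' : fiber pf_proj m) : exists! x, P' = pf_act x P.
Proof.
have [y [n ->]] := pf_fib_ex P; have [y' [n' ->]] := pf_fib_ex P'.
have [x [n'x _]] := coact_torsor n n'.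
exists (y' + alpha m x - y); split.
  rewrite pf_actE subrK; symmetry; apply/pf_fibP; exists x.
  by rewrite addrK.
move=> u; rewrite pf_actE; move/esym/pf_fibP => [x' [-> e]].
have -> : x' = x by apply: (@coact_inj _ _ K _ _ _ n); rewrite -e -n'x.
by rewrite subrK addrK.
Qed.

Fact pf_actM m m' (x : A m) (P : fiber pf_proj m) (y : A m')
    (Q : fiber pf_proj m') :
  fiber_mul (pf_act x P) (pf_act y Q) =
  pf_act (x *# m' + m #* y) (fiber_mul P Q).
Proof.
have [z [n ->]] := pf_fib_ex P; have [w [k ->]] := pf_fib_ex Q.
have mulE (a : A m) (b : A m') : fiber_mul (pf_fib a n) (pf_fib b k) =
    pf_fib (a *# m' + m #* b) (fiber_mul n k).
  by apply: val_inj; exact: pf_mulE.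
by rewrite !pf_actE !mulE pf_actE !raddfD addrACA.
Qed.

Definition pushforward : coextension A :=
  Coextension pf_proj_surj pf_act0 pf_actD pf_act_torsor pf_actM.
End Pushforward.

Definition exact_at (U V W : zmodType) (f : U -> V) (g : V -> W) : Prop :=
  forall v, g v = 0 <-> exists u, f u = v.

(* Exactness of 0 -> U -> V -> W -> Z -> 0. *)
Definition exact_sequence (U V W Z : zmodType) (f : {additive U -> V})
    (g : {additive V -> W}) (h : {additive W -> Z}) : Prop :=
  [/\ injective f, exact_at f g, exact_at g h & forall z, exists w, h w = z].

(* Main.v *)
Require Import Defs.
From HB Require Import structures.
From mathcomp Require Import all_boot all_algebra.
From mathcomp Require Import boolp.

(** Throughout, [s] is a set-theoretic section of [q : K -> M] and [f] is its
    factor set, so that s(a) s(b) = f(a, b) • s(ab); every element of the fibre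
    of [q] over [m] is x • s(m) for a unique x in B(m).

    The key fact is [factor_set_morphism]: if (alpha, h) is a morphism of
    coextensions of M, then h carries a section with factor set f to a section
    with factor set alpha o f; and the class of a factor set does not depend on
    the section ([factor_set_class]).  It is used for two morphisms out of K.
    - The map n |-> [0, n] from K to the push-forward of K along alpha: it shows
      that tau(alpha) is the class of alpha o f, whence tau is additive.
    - A morphism, given by versality, from K to the coextension on the set of
      pairs (a, x), x in A(a), with product twisted by a given cocycle f'
      ([cocycle_coextension]).  Its component alpha then satisfies
      tau(alpha) = [f'], so tau is onto.

    Exactness at the other places concerns functions on the fibres of q.  The
    map eta is injective as q is onto, and theta(d) = 0 says that d is constant
    on fibres, i.e. that it factors through q.  Finally, applying d to the
    equation that defines f gives theta(d) o f = the coboundary of d o s, and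
    conversely, if alpha o f is the coboundary of g, then
    x • s(m) |-> alpha(x) + g(m) is an element of D(q) sent to alpha. *)

Set Implicit Arguments.
Unset Strict Implicit.
Unset Printing Implicit Defensive.

Import GRing.Theory.
Local Open Scope ring_scope.
Local Open Scope group_scope.

(** * Sections of a coextension and their factor sets *)

Fact subr_of_addr_eq (V : zmodType) (x y u v w : V) :
  x + w = u + v + y -> x - y = v - w + u.
Proof.
by move/(canRL (addrK w)) => ->; rewrite [_ + y - w]addrAC addrK [RHS]addrC addrA.
Qed.

Section Sections.
Variables (M : comMonoidType) (A : system M) (C : coextension A).

Definition set_section := forall a : M, fiber (proj C) a.

Definition some_section : set_section := fun a =>
  let: exist n na := cid (proj_surj C a) in in_fiber na.

Lemma coact_mulr m m' (x : A m') (n : fiber (proj C) m) (n' : fiber (proj C) m') :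
  fiber_mul n (x • n') = (m #* x) • fiber_mul n n'.
Proof. by rewrite -{1}(coact0 n) coactM raddf0 add0r. Qed.

Definition coact_diff m (n0 n : fiber (proj C) m) : A m :=
  sval (cid (coact_torsor n0 n)).

Lemma coact_diffK m (n0 n : fiber (proj C) m) : coact_diff n0 n • n0 = n.
Proof. by rewrite /coact_diff; case: cid => x /= []. Qed.

Lemma coact_diffE m (n0 : fiber (proj C) m) (x : A m) : coact_diff n0 (x • n0) = x.
Proof. by apply: (@coact_inj _ _ _ _ _ _ n0); rewrite coact_diffK. Qed.

Lemma factor_set_unique (sigma : set_section) (f : cocycle A) :
  (forall a b, fiber_mul (sigma a) (sigma b) = f a b • sigma (a * b)) ->
  factor_set sigma = f.
Proof.
move=> fP; apply: val_inj; apply: functional_extensionality_dep => a.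
apply: functional_extensionality_dep => b.
apply: (@coact_inj _ _ C _ _ _ (sigma (a * b))).
by rewrite -[RHS]fP -[LHS]factor_funP.
Qed.

Lemma coc_class_eq (f f' : cocycle A) (g : Defs.family A) :
  (forall a b, f a b - f' a b = a #* g b - g (a * b) + g a *# b) ->
  coc_class f = coc_class f'.
Proof.
move=> h; apply/eqP; rewrite piE Quotient.equivE; apply/asboolP.
by exists g => a b; exact: h.
Qed.

Lemma coc_class_eq0 (f : cocycle A) : coc_class f = 0 -> is_coboundary f.
Proof.
move=> h; apply/asboolP; rewrite -[f]subr0.
have: coc_class f == coc_class 0 by rewrite h /coc_class raddf0.
by rewrite piE Quotient.equivE.
Qed.

(** If sigma(a) = g(a) • sigma'(a), then sigma(a) sigma(b) has two expressions
    in terms of sigma'(ab), and comparing them shows that the factor sets differ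
    by the coboundary of g. *)
Lemma factor_set_class (sigma sigma' : set_section) :
  coc_class (factor_set sigma) = coc_class (factor_set sigma').
Proof.
pose g : Defs.family A := fun a => coact_diff (sigma' a) (sigma a).
apply: (coc_class_eq (g := g)) => a b; apply: subr_of_addr_eq.
apply: (@coact_inj _ _ C _ _ _ (sigma' (a * b))).
rewrite coactD coact_diffK -[factor_set _ a b]/(factor_fun _ a b) -factor_funP.
rewrite -(coact_diffK (sigma' a) (sigma a)) -(coact_diffK (sigma' b) (sigma b)).
by rewrite coactM factor_funP -coactD.
Qed.

End Sections.

(** * Factor sets under morphisms of coextensions *)

Lemma cocycleP (M : comMonoidType) (A : system M) (f : cocycle A) :
  is_cocycle (coc_apply f).
Proof. exact/asboolP/(valP f). Qed.

Section HomCocycle.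
Variables (M : comMonoidType) (B A : system M).

Definition hom_cochain (alpha : system_hom B A) (f : cocycle B) : cochain2 A :=
  fun a b => alpha (a * b) (f a b).

Fact hom_cochain_cocycle alpha f : hom_cochain alpha f \in @cocycle_pred M A.
Proof.
have [fC fP] := cocycleP f.
apply/asboolP; split=> [a b|a b c]; first by rewrite -hom_transport -fC.
rewrite -homM -homMr -!hom_transport -!homN -!homD.
by rewrite fP hom0.
Qed.

Definition hom_cocycle alpha f : cocycle A := MkCocycle (hom_cochain_cocycle alpha f).

Lemma hom_cocycleB f : zmod_morphism (hom_cocycle^~ f).
Proof. by move=> alpha beta; apply: val_inj. Qed.

Variables (E : coextension B) (C : coextension A).

(** The composite of [s] with the monoid homomorphism of [phi] is a section of
    [C], and its factor set is the image of that of [s]. *)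
Lemma factor_set_morphism (phi : coext_morphism E C) (s : set_section E)
    (sigma : set_section C) :
  coc_class (factor_set sigma) = coc_class (hom_cocycle (mor_sys phi) (factor_set s)).
Proof.
rewrite (factor_set_class _ (fun a => fiber_map (mor_proj phi) (s a))).
congr coc_class; apply: factor_set_unique => a b.
rewrite -mor_act -[factor_set s a b]/(factor_fun s a b) -factor_funP.
by apply: val_inj; rewrite /= gmulfM.
Qed.

End HomCocycle.

(** * The canonical morphism to the push-forward *)

Section ToPushforward.
Variables (M : comMonoidType) (B : system M) (K : coextension B) (A : system M).
Variable alpha : system_hom B A.

(** The map n |-> [0, n]. *)
Definition to_pf (k : K) : pushforward K alpha :=
  pf_class alpha (0 : A (proj K k)) (in_fiber erefl).

Lemma to_pfE m (k : fiber (proj K) m) : to_pf (val k) = pf_class alpha (0 : A m) k.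
Proof. by apply: (pf_class_eq alpha (e := fiberP k)) => //; rewrite raddf0. Qed.

Fact to_pf_monoid_morphism : monoid.monoid_morphism to_pf.
Proof.
split.
  rewrite -[RHS]/(pf_one K alpha) (@pf_oneE _ _ _ _ _ (in_fiber gmulf1)) //.
  exact: (to_pfE (in_fiber gmulf1)).
move=> k k'; rewrite -[RHS]/(pf_mul _ _) pf_mulE !raddf0 addr0.
exact: (to_pfE (fiber_mul (in_fiber erefl) (in_fiber erefl))).
Qed.
HB.instance Definition _ :=
  isUMagmaMorphism.Build K (pushforward K alpha) to_pf to_pf_monoid_morphism.

Fact to_pf_proj k : proj (pushforward K alpha) (to_pf k) = proj K k.
Proof. exact: pf_proj_class. Qed.

(** This is the relation [0, x • k] = [alpha(x), k] in the push-forward. *)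
Fact to_pf_act m (x : B m) (k : fiber (proj K) m) :
  fiber_map to_pf_proj (x • k) = alpha m x • fiber_map to_pf_proj k.
Proof.
have toE (n : fiber (proj K) m) : fiber_map to_pf_proj n = pf_fib alpha 0 n.
  by apply: val_inj; exact: to_pfE.
rewrite !toE [RHS]pf_actE addr0; symmetry; apply/pf_fibP.
by exists x; rewrite subrr.
Qed.

Definition to_pushforward : coext_morphism K (pushforward K alpha) :=
  @CoextMorphism _ _ _ K (pushforward K alpha) alpha to_pf to_pf_proj to_pf_act.

End ToPushforward.

(** * The coextension defined by a cocycle *)

Section CocycleCoextension.
Variables (M : comMonoidType) (A : system M) (f : cocycle A).

Definition twist : Type := {a : M & A a}.
HB.instance Definition _ := Choice.on twist.

Definition tw (a : M) (x : A a) : twist := Tagged (fun a => A a) x.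
Definition tw_mul (p p' : twist) : twist :=
  tw (tagged p *# tag p' + tag p #* tagged p' + f (tag p) (tag p')).
(** The unit has coordinate - f(1, 1) because the cocycle need not be
    normalised. *)
Definition tw_one : twist := tw (- f 1 1).

Lemma tw_eq a b (e : a = b) (x : A a) (y : A b) : transport e x = y -> tw x = tw y.
Proof. by subst b => <-. Qed.

Fact tw_mulC : commutative tw_mul.
Proof.
have [fC _] := cocycleP f.
move=> [a x] [b y]; apply: (tw_eq (e := commM a b)) => /=.
rewrite !raddfD /= (fC b a); congr (_ + _).
rewrite addrC; congr (_ + _).
by rewrite !sys_mapr_push !sys_map_push transport_push; apply: pushE.
Qed.

Fact tw_mulA : associative tw_mul.
Proof.
have [_ fP] := cocycleP f.
move=> [a x] [b y] [c z]; apply: (tw_eq (e := mulgA a b c)) => /=.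
rewrite !raddfD /=.
(* the cocycle identity with its negative terms moved to the right *)
have fP' : transport (mulgA a b c) (a #* f b c)
      + transport (mulgA a b c) (f a (b * c)) = f a b *# c + f (a * b) c.
  apply/eqP; rewrite -subr_eq0 opprD (addrC (- (f a b *# c))) addrA.
  by rewrite (addrAC (transport _ (a #* _))) fP.
rewrite -!addrA fP' !addrA.
rewrite [X in _ = X + _]addrAC.
congr (_ + _ + _ + _ + _).
- by rewrite !sys_mapr_push transport_push push_push; apply: pushE; rewrite commM.
- rewrite !sys_mapr_push !sys_map_push transport_push !push_push.
  by apply: pushE; rewrite commM.
- by rewrite !sys_map_push transport_push !push_push; apply: pushE.
Qed.

Lemma cocycle_transport a a' b b' (e : a * b = a' * b') :
  a = a' -> b = b' -> transport e (f a b) = f a' b'.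
Proof. by move=> aa' bb'; subst a' b'; rewrite transport_id. Qed.

Lemma push_one a b (e : 1 * a = b) (x : A a) :
  push e x = transport (etrans (esym (mul1g a)) e) x.
Proof. by subst b; rewrite -[in RHS](push1 (mul1g a) x) transport_push; apply: pushE. Qed.

(** The cocycle identity at (1, 1, c), in which two terms agree up to transport
    and cancel.  The product 1 * 1 stays unreduced because that is the component
    of [tw_one], where this identity gives the unit law. *)
Lemma cocycle_one c : f 1 1 *# c = f (1 * 1) c.
Proof.
have [_ fP] := cocycleP f.
have := fP 1 1 c; rewrite sys_map_push transport_push.
rewrite push_one !cocycle_transport ?mul1g // subrr add0r => /eqP.
by rewrite subr_eq0 => /eqP.
Qed.

Fact tw_mul1 : left_id tw_one tw_mul.
Proof.
move=> [a x].
have e : 1 * 1 * a = a by rewrite !mul1g.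
apply: (tw_eq (e := e)) => /=; rewrite raddfN /= cocycle_one addrAC addNr add0r.
have e1 : 1 * a = a by rewrite mul1g.
by rewrite sys_map_push transport_push (pushE _ e1) ?push1 ?mul1g.
Qed.

Fact tw_mulr1 : right_id tw_one tw_mul.
Proof. by move=> p; rewrite tw_mulC tw_mul1. Qed.

HB.instance Definition _ := isMonoid.Build twist tw_mulA tw_mul1 tw_mulr1.
HB.instance Definition _ := Monoid_isCommutative.Build twist tw_mulC.

Definition tw_proj_fun (p : twist) : M := tag p.
Fact tw_proj_monoid_morphism : monoid.monoid_morphism tw_proj_fun.
Proof. by split=> //; exact: mul1g. Qed.
HB.instance Definition _ :=
  isUMagmaMorphism.Build twist M tw_proj_fun tw_proj_monoid_morphism.
Definition tw_proj : {monoidHom twist -> M} := tw_proj_fun.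

Fact tw_proj_surj m : exists p, tw_proj p = m.
Proof. by exists (tw (0 : A m)). Qed.

Definition tw_fib m (x : A m) : fiber tw_proj m := in_fiber (erefl : tw_proj (tw x) = m).

Definition tw_coord m (p : fiber tw_proj m) : A m :=
  transport (fiberP p : tag (val p) = m) (tagged (val p)).

Lemma tw_fibK m : cancel (@tw_fib m) (@tw_coord m).
Proof. by move=> x; rewrite /tw_coord transport_id. Qed.

Lemma tw_coordK m : cancel (@tw_coord m) (@tw_fib m).
Proof.
move=> p; apply: val_inj; rewrite [LHS]/= /tw_coord.
by move: (fiberP p); case: p => -[a x] /= _ e; symmetry; apply: (tw_eq (e := e)).
Qed.

Definition tw_act m (x : A m) (p : fiber tw_proj m) : fiber tw_proj m :=
  tw_fib (x + tw_coord p).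

Fact tw_act0 m (p : fiber tw_proj m) : tw_act 0 p = p.
Proof. by rewrite /tw_act add0r tw_coordK. Qed.

Fact tw_actD m (x y : A m) (p : fiber tw_proj m) :
  tw_act (x + y) p = tw_act x (tw_act y p).
Proof. by rewrite /tw_act tw_fibK addrA. Qed.

Fact tw_act_torsor m (p p' : fiber tw_proj m) : exists! x, p' = tw_act x p.
Proof.
exists (tw_coord p' - tw_coord p); split; first by rewrite /tw_act subrK tw_coordK.
by move=> x ->; rewrite /tw_act tw_fibK addrK.
Qed.

Lemma tw_fib_mul m m' (x : A m) (y : A m') :
  fiber_mul (tw_fib x) (tw_fib y) = tw_fib (x *# m' + m #* y + f m m').
Proof. exact: val_inj. Qed.

Fact tw_actM m m' (x : A m) (p : fiber tw_proj m) (y : A m') (p' : fiber tw_proj m') :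
  fiber_mul (tw_act x p) (tw_act y p') =
  tw_act (x *# m' + m #* y) (fiber_mul p p').
Proof.
rewrite -(tw_coordK p) -(tw_coordK p') /tw_act !tw_fibK !tw_fib_mul tw_fibK.
by rewrite !raddfD /= addrACA !addrA.
Qed.

Definition cocycle_coextension : coextension A :=
  Coextension tw_proj_surj tw_act0 tw_actD tw_act_torsor tw_actM.

Lemma cocycle_coextension_factor :
  factor_set (C := cocycle_coextension) (fun a => tw_fib (0 : A a)) = f.
Proof.
apply: factor_set_unique => a b; rewrite [RHS]/= /tw_act.
by rewrite [LHS]tw_fib_mul !raddf0 !add0r tw_fibK addr0.
Qed.

End CocycleCoextension.

(** * Derivations as functions on fibres *)

Lemma transport_irrelevance (T : eqType) (F : T -> zmodType) a b (e e' : a = b)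
  (x : F a) : transport e x = transport e' x.
Proof. by rewrite (eq_irrelevance e e'). Qed.

Lemma derivationP (M : comMonoidType) (A : system M) (d : D0 A) :
  is_derivation (der_apply d).
Proof. exact/asboolP/(valP d). Qed.

Section DerivationsOnFibers.
Variables (M : comMonoidType) (B : system M) (K : coextension B) (A : system M).
Let q := proj K.

Lemma pullback_mapE (r k : K) (x : A (q k)) :
  (r #* (x : pullback q A k)) = transport (esym (gmulfM r k)) (q r #* x).
Proof. by []. Qed.

Lemma pullback_maprE (k r : K) (x : A (q k)) :
  ((x : pullback q A k) *# r) = transport (esym (gmulfM k r)) (x *# q r).
Proof.
rewrite /sys_mapr (@pullback_transport _ _ q A) pullback_mapE !transport_comp.
exact (@transport_irrelevance M A _ _ _ _ (q r #* x)).
Qed.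

Lemma der_at_mul (d : D0 (pullback q A)) m m' (n : fiber q m) (n' : fiber q m') :
  der_at d (fiber_mul n n') = m #* der_at d n' + der_at d n *# m'.
Proof.
case: n n' => [k e] [k' e']; move: (e) (e').
move/eqP: e => <-; move/eqP: e' => <- e e'.
rewrite /der_at /= !transport_id derivationP.
rewrite pullback_maprE pullback_mapE raddfD /= !transport_comp !transport_id.
by congr (_ + _); exact: transport_irrelevance.
Qed.

(** A family of functions on the fibres of [q] amounts to a single function on
    K; the converse passage is [der_at], by [fiber_derE]. *)
Definition fiber_der (F : forall m, fiber q m -> A m) : Defs.family (pullback q A) :=
  fun k => F (q k) (in_fiber erefl).

Lemma fiber_fun_transport (F : forall m, fiber q m -> A m) m m' (e : m = m')
    (n : fiber q m) (n' : fiber q m') :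
  val n = val n' -> transport e (F m n) = F m' n'.
Proof. by subst m' => nn'; congr F; apply: val_inj. Qed.

Lemma fiber_derP F :
  (forall m m' (n : fiber q m) (n' : fiber q m'),
    F _ (fiber_mul n n') = m #* F _ n' + F _ n *# m') ->
  fiber_der F \in @derivation_pred _ (pullback q A).
Proof.
move=> FM; apply/asboolP => k k'.
rewrite pullback_maprE pullback_mapE.
apply: (@transport_inj _ A _ _ (gmulfM k k')).
rewrite raddfD /= !transport_comp !transport_id.
pose kk' : fiber q (q k * q k') := fiber_mul (in_fiber erefl) (in_fiber erefl).
rewrite /fiber_der (fiber_fun_transport _ _ (n' := kk')) //.
by rewrite FM; congr (_ + _); exact: transport_irrelevance.
Qed.

Lemma fiber_derE F (d : D0 (pullback q A)) m (n : fiber q m) :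
  der_fun d = fiber_der F -> der_at d n = F m n.
Proof.
move=> dF; rewrite /der_at -[d _]/(der_fun d _) dF.
exact: fiber_fun_transport.
Qed.

Lemma der_at_val (d : D0 (pullback q A)) (k : K) :
  der_at d (in_fiber (erefl (q k))) = d k.
Proof. by rewrite /der_at transport_id. Qed.

Lemma Dq_atP (d d' : Dq K A) :
  (forall m (n : fiber q m), der_at d n = der_at d' n) -> d = d'.
Proof.
move=> dd'; do 2 apply: val_inj; apply: functional_extensionality_dep => k.
by move: (dd' _ (in_fiber (erefl (q k)))); rewrite !der_at_val.
Qed.

Lemma Dq_at (d : Dq K A) : Dq_cond d.
Proof. exact/asboolP/(valP d). Qed.

End DerivationsOnFibers.

(** * The maps of the sequence and its exactness *)

Section Maps.
Variables (M : comMonoidType) (B : system M) (K : coextension B) (A : system M).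
Let q := proj K.
Let s : set_section K := some_section K.

Fact eta_der_derivation (delta : D0 A) :
  fiber_der (K := K) (fun m _ => delta m) \in @derivation_pred _ (pullback q A).
Proof.
apply: (@fiber_derP _ _ _ _ (fun m _ => delta m)) => m m' _ _.
exact: derivationP.
Qed.

Definition eta_der (delta : D0 A) : D0 (pullback q A) := MkD0 (eta_der_derivation delta).

Lemma eta_der_at delta m (n : fiber q m) : der_at (eta_der delta) n = delta m.
Proof. by rewrite (@fiber_derE _ _ _ _ (fun m _ => delta m)). Qed.

Fact eta_der_Dq (delta : D0 A) : eta_der delta \in @Dq_pred _ _ K A.
Proof. by apply/asboolP => m x y n; rewrite !eta_der_at. Qed.

Definition eta (delta : D0 A) : Dq K A := MkDq (eta_der_Dq delta).

Fact eta_additive : zmod_morphism eta.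
Proof. by move=> d d'; do 2 apply: val_inj. Qed.
HB.instance Definition _ := GRing.isZmodMorphism.Build (D0 A) (Dq K A) eta eta_additive.

Lemma eta_inj : injective eta.
Proof.
move=> d d' e; apply: val_inj; apply: functional_extensionality_dep => m.
by rewrite -[LHS]/(d m) -[RHS]/(d' m) -(eta_der_at d (s m)) -(eta_der_at d' (s m))
   -[eta_der d]/(Dq_der (eta d)) e.
Qed.

Definition theta_fun (d : Dq K A) : hom_family B A :=
  fun m x => der_at d (x • s m) - der_at d (s m).

(** Writing n = y • s(m), this is the defining condition of D(q). *)
Lemma theta_funE d m (x : B m) (n : fiber q m) :
  theta_fun d x = der_at d (x • n) - der_at d n.
Proof.
rewrite -(coact_diffK (s m) n) -coactD; set y := coact_diff _ _.
rewrite -[LHS]/(der_at d (x • s m) - der_at d (s m)).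
by apply/esym/eqP; rewrite subr_eq addrAC eq_sym subr_eq eq_sym; apply/eqP/Dq_at.
Qed.

Fact theta_hom d : theta_fun d \in @hom_pred _ B A.
Proof.
apply/asboolP; split=> [m x y|r m x].
  rewrite (theta_funE _ (x + y) (s m)) (theta_funE _ x (y • s m)) -coactD.
  by rewrite (theta_funE _ y (s m)) addrA subrK.
(* s(r) s(m) lies over rm, and there the product rule reduces both values of d
   to values over r and m; the terms in d (s r) cancel *)
rewrite (theta_funE _ _ (fiber_mul (s r) (s m))) -coact_mulr !der_at_mul.
by rewrite opprD addrACA subrr addr0 -raddfB.
Qed.

Definition theta (d : Dq K A) : system_hom B A := MkSystemHom (theta_hom d).

Fact theta_additive : zmod_morphism theta.
Proof.
move=> d d'; apply: val_inj.
apply: functional_extensionality_dep => m; apply: functional_extensionality_dep => x.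
rewrite -[LHS]/(der_at (d - d' : Dq K A) _ - der_at (d - d' : Dq K A) _).
by rewrite !der_atB opprD addrACA -opprD.
Qed.
HB.instance Definition _ :=
  GRing.isZmodMorphism.Build (Dq K A) (system_hom B A) theta theta_additive.

Lemma system_homP (alpha beta : system_hom B A) :
  (forall m x, alpha m x = beta m x) -> alpha = beta.
Proof.
move=> ab; apply: val_inj.
by do 2 (apply: functional_extensionality_dep => ?); exact: ab.
Qed.

(** If theta(d) = 0 then d is constant on fibres, because B(m) acts
    transitively on them, and d o s is a derivation of M. *)
Lemma eta_theta_exact : exact_at eta theta.
Proof.
move=> d; split=> [d0|[delta <-]]; last first.
  by apply: system_homP => m x; rewrite [LHS](theta_funE _ _ (s m)) !eta_der_at subrr.
have dconst m (n n' : fiber q m) : der_at d n = der_at d n'.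
  rewrite -(coact_diffK n' n); apply/eqP; rewrite -subr_eq0 -theta_funE.
  by rewrite -[theta_fun _ _]/(theta d m _) d0.
have deltaP : (fun m => der_at d (s m)) \in @derivation_pred _ A.
  by apply/asboolP => a b; rewrite -der_at_mul.
by exists (MkD0 deltaP); apply: Dq_atP => m n; rewrite eta_der_at; exact: dconst.
Qed.

(** Defined through the factor set of K, which makes additivity immediate;
    [tauE] identifies it with the class of the push-forward. *)
Definition tau (alpha : system_hom B A) : D1 A :=
  coc_class (hom_cocycle alpha (factor_set s)).

Fact tau_additive : zmod_morphism tau.
Proof. by move=> a b; rewrite /tau hom_cocycleB /coc_class raddfB. Qed.
HB.instance Definition _ :=
  GRing.isZmodMorphism.Build (system_hom B A) (D1 A) tau tau_additive.

(** If alpha o f is the coboundary of g, the function F taking x • s(m) to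
    alpha(x) + g(m) is a derivation, since s(a) s(b) differs from s(ab) by
    f(a, b).  Conversely d o s has coboundary theta(d) o f, by the product rule
    for d. *)
Lemma theta_tau_exact : exact_at theta tau.
Proof.
move=> alpha; split=> [/coc_class_eq0[g gP]|[d <-]].
  pose F m (n : fiber q m) := alpha m (coact_diff (s m) n) + g m.
  have FM m m' (n : fiber q m) (n' : fiber q m') :
      F _ (fiber_mul n n') = m #* F _ n' + F _ n *# m'.
    rewrite -(coact_diffK (s m) n) -(coact_diffK (s m') n') coactM.
    rewrite factor_funP -coactD /F !coact_diffE !homD homM homMr !raddfD /=.
    rewrite -[alpha _ (factor_fun _ _ _)]/(hom_cocycle alpha (factor_set s) m m') gP.
    rewrite -[LHS]addrA (addrAC (m #* _)) subrK.
    by rewrite [RHS]addrC [RHS]addrACA [g m *# m' + _]addrC.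
  (* F is affine on each fibre *)
  have FDq : (MkD0 (fiber_derP FM)) \in @Dq_pred _ _ K A.
    apply/asboolP => m x y n; rewrite !(@fiber_derE _ _ _ _ F) //.
    rewrite -(coact_diffK (s m) n) -!coactD /F !coact_diffE !homD.
    set z := alpha m (coact_diff _ _); rewrite -!addrA; congr (_ + _).
    by rewrite (addrCA (g m) (alpha m y)) (addrCA z (alpha m y)).
  exists (MkDq FDq); apply: system_homP => m x.
  rewrite [LHS](theta_funE _ _ (s m)) !(@fiber_derE _ _ _ _ F) //.
  rewrite /F coact_diffE -[X in coact_diff _ X]coact0 coact_diffE hom0.
  by rewrite add0r addrK.
have <- : coc_class (0 : cocycle A) = 0 by rewrite /coc_class raddf0.
apply: (coc_class_eq (g := fun m => der_at d (s m))) => a b.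
rewrite -[X in X - _ = _]/(theta_fun d (factor_fun s a b)) (theta_funE _ _ (s (a * b))).
rewrite -factor_funP der_at_mul -[X in _ - X]/(0 : A (a * b)) subr0.
by rewrite addrAC.
Qed.

(** The coextension built from a representative of z has that representative as
    the factor set of its zero section, and versality maps K to it. *)
Lemma tau_surj : versal K -> forall z : D1 A, exists alpha, tau alpha = z.
Proof.
move=> vK z; have [phi] := vK A (cocycle_coextension (repr z)).
exists (mor_sys phi).
rewrite /tau -(factor_set_morphism phi s (fun a => tw_fib _ (0 : A a))).
by rewrite cocycle_coextension_factor /coc_class reprK.
Qed.

Lemma tauE alpha (sigma : set_section (pushforward K alpha)) :
  tau alpha = coc_class (factor_set sigma).
Proof. by rewrite (factor_set_morphism (to_pushforward K alpha) s sigma). Qed.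

End Maps.

Theorem corollary4p10 (M : comMonoidType) (B : system M) (K : coextension B)
    (versalK : versal K) (A : system M) :
  exists (eta : {additive D0 A -> Dq K A})
         (theta : {additive Dq K A -> system_hom B A})
         (tau : {additive system_hom B A -> D1 A}),
  [/\ forall (delta : D0 A) (k : K), eta delta k = delta (proj K k),
      forall (d : Dq K A) (m : M) (x : B m) (n : fiber (proj K) m),
        theta d m x = der_at d (x • n) - der_at d n,
      forall (alpha : system_hom B A)
             (sigma : forall a : M, fiber (proj (pushforward K alpha)) a),
        tau alpha = coc_class (factor_set sigma)
    & exact_sequence eta theta tau].
Proof.
exists (@eta M B K A), (@theta M B K A), (@tau M B K A); split.
- by [].
- exact: theta_funE.
- exact: tauE.
split.
- exact: eta_inj.
- exact: eta_theta_exact.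
- exact: theta_tau_exact.
- exact: tau_surj.
Qed.
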